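(* Let $\mathbf z_0=(\mathbf Q,\mathbf P,\boldsymbol l,\mathbf a)$ be the initial condition of a relative equilibrium with rotation vector $\boldsymbol\omega=\omega\mathbf e_z$ of the axially symmetric full gravitational $N$-body system described in the context, with components $\mathbf q_{ij},\mathbf p_{ij}$ ($1\le i<j\le N$), $\boldsymbol l_j$ and $\mathbf a_j=(u_j,v_j,w_j)$ ($1\le j\le m$). Then the following relations hold. (i) (Momenta determined by coordinates) For all $1\le i<j\le N$, $$\mathbf p_{ij}=\boldsymbol\omega\times\left[\frac{m_i}{N\,m_s}\sum_{k\ne i}m_k\,\mathbf q_{ik}+\frac{m_j}{N\,m_s}\sum_{k\neq j}m_k\,\mathbf q_{kj}\right],$$ and for all $j=1,\dots,m$, $$\boldsymbol l_j=\Theta_{j1}\,\boldsymbol\omega+k_j\,w_j\,\mathbf a_j,$$ where either $k_j=\omega(\Theta_{j3}-\Theta_{j1})$ or $k_j=0$. (ii) (Equations for the coordinates) For all $1\le i<j\le N$, $$\frac1N\,\widehat{\boldsymbol\omega}^2\left[\frac{m_i}{m_s}\sum_{k\neq i}m_k\,\mathbf q_{ik}+\frac{m_j}{m_s}\sum_{k\ne j}m_k\,\mathbf q_{kj}\right]=-\frac{\partial V}{\partial\mathbf q_{ij}},$$ and for all $j=1,\dots,m$ there is a constant $\mu_j\in\mathbb R$ such that $$\mu_j\,\mathbf a_j=k_j\,w_j\,\boldsymbol\omega-\frac{\partial V}{\partial\mathbf a_j}.$$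
   Context: Setting: $N$ rigid bodies with masses $m_1,\dots,m_N>0$, total mass $m_s=m_1+\cdots+m_N$; bodies $1,\dots,m$ are axially symmetric with body-frame inertia tensor $\mathbb I_j=\mathrm{Diag}(\Theta_{j1},\Theta_{j1},\Theta_{j3})$ and unit symmetry axis $\mathbf a_j\in\mathbb R^3$ (in the spatial frame), and bodies $m+1,\dots,N$ are spherically symmetric. $\boldsymbol l_j\in\mathbb R^3$ is the angular momentum of body $j$ in the spatial frame. With $\tilde{\mathbf q}_i,\tilde{\mathbf p}_i$ the barycentric positions and momenta, the relative variables are $\mathbf q_{ij}=\tilde{\mathbf q}_i-\tilde{\mathbf q}_j$, $\mathbf p_{ij}=\frac1N(\tilde{\mathbf p}_i-\tilde{\mathbf p}_j)$ (so $\mathbf q_{ji}=-\mathbf q_{ij}$, $\mathbf p_{ji}=-\mathbf p_{ij}$), and they satisfy $\mathbf q_{ij}+\mathbf q_{jk}-\mathbf q_{ik}=0$ and $\mathbf p_{ij}+\mathbf p_{jk}-\mathbf p_{ik}=0$. $\mathbf Q=(\mathbf q_{ij})_{i<j}$, $\mathbf P=(\mathbf p_{ij})_{i<j}$, $\boldsymbol l=(\boldsymbol l_1,\dots,\boldsymbol l_m)$, $\mathbf a=(\mathbf a_1,\dots,\mathbf a_m)$. The potential is $$V=-\mathcal G\sum_{i<j}\int_{\mathcal B_i}\int_{\mathcal B_j}\frac{dm(\mathbf X_i)\,dm(\mathbf X_j)}{\|\mathbf q_{ij}+A_i\mathbf X_i-A_j\mathbf X_j\|},$$ where $\mathcal B_i$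 is body $i$, $\mathcal G$ is the gravitational constant and $A_i\in SO(3)$ is the attitude matrix of body $i$ (body to spatial), whose third column is $\mathbf a_i$ for $i\le m$; because of the symmetry of the bodies $V=V(\mathbf Q,\mathbf a)$. The equations of motion are $$\dot{\mathbf p}_{ij}=-\frac{\partial V}{\partial\mathbf q_{ij}},\quad \dot{\mathbf q}_{ij}=\frac1{m_i}\sum_{k\ne i}\mathbf p_{ik}+\frac1{m_j}\sum_{k\ne j}\mathbf p_{kj}\quad(1\le i<j\le N),$$ $$\dot{\mathbf a}_j=\frac1{\Theta_{j1}}\boldsymbol l_j\times\mathbf a_j,\quad \dot{\boldsymbol l}_j=\frac{\partial V}{\partial\mathbf a_j}\times\mathbf a_j\quad(1\le j\le m).$$ For $\mathbf x\in\mathbb R^3$, $\widehat{\mathbf x}$ is the antisymmetric matrix with $\widehat{\mathbf x}\mathbf y=\mathbf x\times\mathbf y$. A relative equilibrium with rotation vector $\boldsymbol\omega=\omega\mathbf e_z$, $\mathbf e_z=(0,0,1)^T$, is a solution of the form $\mathbf q_{ij}(t)=e^{\widehat{\boldsymbol\omega}t}\mathbf q_{ij}$, $\mathbf p_{ij}(t)=e^{\widehat{\boldsymbol\omega}t}\mathbf p_{ij}$, $\mathbf a_j(t)=e^{\widehat{\boldsymbol\omega}t}\mathbf a_j$, $\boldsymbol l_j(t)=e^{\widehat{\boldsymbol\omega}t}\boldsymbol l_j$, where the unadorned symbols on the right denote initial values. Each axially symmetric body rotates rigidly with spatial angular velocity $\boldsymbol\omega$, i.e. $A_j(t)=e^{\widehat{\boldsymbol\omega}t}A_j(0)$,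 and $\boldsymbol l_j=A_j\mathbb I_jA_j^T\boldsymbol\omega$, so that $\langle\boldsymbol l_j,\mathbf a_j\rangle=\Theta_{j3}\,\omega\,w_j$. *)

(* Defs.v *)
From HB Require Import structures.
From mathcomp Require Import all_boot all_order all_algebra.
From mathcomp Require Import all_classical all_reals all_analysis.

Set Implicit Arguments.
Unset Strict Implicit.
Unset Printing Implicit Defensive.

Import Order.TTheory GRing.Theory Num.Theory.
Import numFieldNormedType.Exports.

Local Open Scope classical_set_scope.
Local Open Scope ring_scope.

Notation vec3 R := 'cV[R]_3.

Section Euclidean.
Variable R : realType.
Implicit Types (x y : vec3 R) (A : 'M[R]_3).

(* Vector components are indexed by 'I_3 = {0, 1, 2}, with addition mod 3. *)
Definition cross x y : vec3 R :=
  \col_i (x (i + 1) 0 * y (i + 2) 0 - x (i + 2) 0 * y (i + 1) 0).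

Definition hat x : 'M[R]_3 := \matrix_(i, j) cross x (delta_mx j 0) i 0.

Lemma mul_hat x y : hat x *m y = cross x y.
Proof.
apply/colP => i; rewrite !mxE.
under eq_bigr do rewrite !mxE !andbT mulrBl -!mulrA.
rewrite sumrB -!mulr_sumr.
have pick k : \sum_j (k == j)%:R * y j 0 = y k 0.
  rewrite (bigD1 k) //= eqxx mul1r big1 ?addr0 // => j.
  by rewrite eq_sym => /negPf ->; rewrite mul0r.
by rewrite !pick.
Qed.

Lemma tr_hat x : (hat x)^T = - hat x.
Proof.
have i3 (P : 'I_3 -> Prop) : P 0 -> P 1 -> P 2 -> forall i, P i.
  move=> P0 P1 P2 [[|[|[|//]]] ?]; [move: P0|move: P1|move: P2];
  by congr P; apply: val_inj.
by apply/matrixP => i j; elim/i3: i; elim/i3: j; rewrite !mxE /=;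
  rewrite ?(mulr0, mulr1, subr0, sub0r, oppr0, opprK, subrr);
  do ?congr (x _ _); do ?congr (- (x _ _)); try exact: val_inj.
Qed.

(* The ambient norm `|x| of 'cV[R]_3 is the sup norm. *)
Definition enorm x : R := Num.sqrt (\sum_i x i 0 ^+ 2).

Definition SO3 : set 'M[R]_3 := [set A | A^T *m A = 1%:M /\ \det A = 1].

Definition ez : vec3 R := delta_mx 2 0.

Definition expmx A : 'M[R]_3 :=
  limn (series (fun k : nat => (k`!%:R)^-1 *: A ^+ k)).

End Euclidean.

Section Bodies.
Variable R : realType.

Definition borel3 := g_sigma_algebraType (@open (vec3 R)).

Record body := Body {
  region : set (vec3 R);
  region_compact : compact region;
  mass_measure : {finite_measure set borel3 -> \bar R} }.

Definition mass (b : body) : R := fine (mass_measure b (region b)).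

Definition inertia (b : body) : 'M[R]_3 :=
  \matrix_(i, j) \int[mass_measure b]_(X in region b)
    (enorm X ^+ 2 * (i == j)%:R - X i 0 * X j 0).

Definition invariant_under (g : 'M[R]_3) (b : body) : Prop :=
  mulmx g @` region b = region b /\
  forall U : set borel3, measurable U ->
    mass_measure b (region b `&` mulmx g @^-1` U) =
    mass_measure b (region b `&` U).

Definition axially_symmetric (b : body) : Prop :=
  forall g, SO3 g -> g *m ez R = ez R -> invariant_under g b.

Definition spherically_symmetric (b : body) : Prop :=
  forall g, SO3 g -> invariant_under g b.

(* Bodies are numbered from 0; those with i < m are the axially symmetric ones. *)
Record nbody (N m : nat) := NBody {
  le_mN : (m <= N)%N;
  grav : R;
  grav_gt0 : 0 < grav;
  bodies : 'I_N -> body;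
  mass_gt0 : forall i, 0 < mass (bodies i);
  Theta1 : 'I_m -> R;
  Theta3 : 'I_m -> R;
  Theta1_gt0 : forall j, 0 < Theta1 j;
  axial_bodies : forall j : 'I_m,
    axially_symmetric (bodies (widen_ord le_mN j));
  inertia_axial : forall j : 'I_m,
    inertia (bodies (widen_ord le_mN j)) =
    diag_mx (\row_k if k == 2 then Theta3 j else Theta1 j);
  spherical_bodies : forall i : 'I_N, (m <= i)%N ->
    spherically_symmetric (bodies i) }.

End Bodies.

Arguments ez {R}.

Section Dynamics.
Variables (R : realType) (N m : nat) (S : nbody R N m).

Definition m_ (i : 'I_N) : R := mass (bodies S i).
Definition m_s : R := \sum_i m_ i.

Definition edge := {p : 'I_N * 'I_N | (p.1 < p.2)%N}.

Definition Edge (i j : 'I_N) (ij : (i < j)%N) : edge := exist _ (i, j) ij.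

(* A family (x_ij)_{i<j} of vectors is stored columnwise in a matrix, so that *)
(* the configurations (Q, a) range over a normed space.                       *)
Definition pairs := 'M[R]_(3, #|{: edge}|).

Definition pcol (X : pairs) (e : edge) : vec3 R := col (enum_rank e) X.

(* x_ij for arbitrary i, j, with x_ji = - x_ij. *)
Definition pr (X : pairs) (i j : 'I_N) : vec3 R :=
  if insub (i, j) is Some e then pcol X e
  else if insub (j, i) is Some e then - pcol X e else 0.

Definition relative_positions (Q : pairs) : Prop :=
  exists q : 'I_N -> vec3 R, \sum_i m_ i *: q i = 0 /\
    forall i j, pr Q i j = q i - q j.

Definition relative_momenta (P : pairs) : Prop :=
  exists p : 'I_N -> vec3 R, \sum_i p i = 0 /\
    forall i j, pr P i j = N%:R^-1 *: (p i - p j).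

Definition newton_potential (Q : pairs) (A : 'I_N -> 'M[R]_3) : R :=
  - grav S * \sum_(e : edge)
    let i := (val e).1 in let j := (val e).2 in
    \int[mass_measure (bodies S i)]_(X in region (bodies S i))
      \int[mass_measure (bodies S j)]_(Y in region (bodies S j))
        (enorm (pcol Q e + A i *m X - A j *m Y))^-1.

Definition config := (pairs * 'M[R]_(3, m))%type.

(* The coordinates (Q, a) are redundant: physical configurations satisfy      *)
(* q_ij + q_jk - q_ik = 0 and |a_j| = 1, so the partial derivatives with       *)
(* respect to q_ij and a_j need V on a neighbourhood of them.  V may be any    *)
(* function agreeing with the Newtonian integral on physical configurations:   *)
(* e.g. the integral itself as a function of independent q_ij, or its          *)
(* restriction extended constantly along the normal directions, for which      *)
(* the partial derivatives form the gradient within the constraint space.      *)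
Definition is_potential (V : config -> R) : Prop :=
  forall (Q : pairs) (a : 'M[R]_(3, m)) (A : 'I_N -> 'M[R]_3),
    relative_positions Q -> (forall i, SO3 (A i)) ->
    (forall j, col j a = col 2 (A (widen_ord (le_mN S) j))) ->
    V (Q, a) = newton_potential Q A.

Definition dVdq (V : config -> R) (Q : pairs) (a : 'M[R]_(3, m)) (e : edge) :
    vec3 R :=
  \col_k 'D_((delta_mx k (enum_rank e), 0) : config) V (Q, a).

Definition dVda (V : config -> R) (Q : pairs) (a : 'M[R]_(3, m)) (j : 'I_m) :
    vec3 R :=
  \col_k 'D_((0, delta_mx k j) : config) V (Q, a).

Record state := State {
  sQ : pairs;
  sP : pairs;
  sl : 'M[R]_(3, m);
  sa : 'M[R]_(3, m) }.

Definition act (g : 'M[R]_3) (z : state) : state :=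
  State (g *m sQ z) (g *m sP z) (g *m sl z) (g *m sa z).

Record is_solution (V : config -> R) (z : R -> state) : Prop := IsSolution {
  sol_Q : forall t, relative_positions (sQ (z t));
  sol_P : forall t, relative_momenta (sP (z t));
  sol_a : forall t j, enorm (col j (sa (z t))) = 1;
  sol_V : forall t, differentiable V (sQ (z t), sa (z t));
  sol_dP : forall (t : R) (i j : 'I_N) (ij : (i < j)%N),
    is_derive t 1 (fun s => pr (sP (z s)) i j)
      (- dVdq V (sQ (z t)) (sa (z t)) (Edge ij));
  sol_dQ : forall (t : R) (i j : 'I_N), (i < j)%N ->
    is_derive t 1 (fun s => pr (sQ (z s)) i j)
      ((m_ i)^-1 *: (\sum_(k | k != i) pr (sP (z t)) i k) +
       (m_ j)^-1 *: (\sum_(k | k != j) pr (sP (z t)) k j));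
  sol_da : forall (t : R) (j : 'I_m),
    is_derive t 1 (fun s => col j (sa (z s)))
      ((Theta1 S j)^-1 *: cross (col j (sl (z t))) (col j (sa (z t))));
  sol_dl : forall (t : R) (j : 'I_m),
    is_derive t 1 (fun s => col j (sl (z s)))
      (cross (dVda V (sQ (z t)) (sa (z t)) j) (col j (sa (z t)))) }.

Definition relative_equilibrium (V : config -> R) (omega : R) (z0 : state) :
    Prop :=
  let W := omega *: ez in
  let z t := act (expmx (t *: hat W)) z0 in
  is_solution V z /\
  exists A : 'I_m -> R -> 'M[R]_3, forall j,
    (forall t, [/\ SO3 (A j t), col 2 (A j t) = col j (sa (z t)) &
                   A j t = expmx (t *: hat W) *m A j 0]) /\
    col j (sl z0) =
      A j 0 *m inertia (bodies S (widen_ord (le_mN S) j)) *m (A j 0)^T *m W.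

End Dynamics.

(* Main.v *)
Require Import Defs.
From HB Require Import structures.
From mathcomp Require Import all_boot all_order all_algebra.
From mathcomp Require Import all_classical all_reals all_analysis.
From mathcomp Require Import ring.

Set Implicit Arguments.
Unset Strict Implicit.
Unset Printing Implicit Defensive.

Import Order.TTheory GRing.Theory Num.Theory.
Import numFieldNormedType.Exports.

Local Open Scope classical_set_scope.
Local Open Scope ring_scope.

(** A relative equilibrium is the orbit of its initial value under the
    rotations exp(t hat(W)).  By Rodrigues' formula ([expmx_hat]) this
    exponential is an explicit trigonometric expression in t, so every vector
    b(t) = exp(t hat(W)) b of the motion has the velocity W x b at t = 0
    ([is_derive_rotation]).  Comparing with the equations of motion at the
    single time t = 0 turns them into algebraic relations for the initial
    value, and these suffice.

    Orbital part.  Write q_ij = q_i - q_j and p_ij = (p_i - p_j)/N with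
    sum m_i q_i = 0 and sum p_i = 0.  A weighted sum of differences collapses
    to a multiple of one vector ([sum_weighted_diff]), so the equation for q_ij
    says W x (q_i - q_j) = p_i/m_i - p_j/m_j.  Hence p_i/m_i - W x q_i does not
    depend on i; its mass-weighted sum is zero, so it is zero and
    p_i = m_i W x q_i ([weighted_const_eq0], [relative_momentum]).  The same
    collapse identifies the bracket in the formula for p_ij with
    (m_i q_i - m_j q_j)/N ([bracketE]).  This gives that formula, and the equation W x p_ij = - dV/dq_ij gives the balance of
    forces.

    Rotational part.  The inertia tensor of an axially symmetric body in the
    spatial frame is Theta_1 Id + (Theta_3 - Theta_1) a a^T
    ([axial_inertia_mul]); applied to W it yields l_j with
    k_j = omega (Theta_j3 - Theta_j1).  The equation W x l_j = dV/da_j x a_j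
    then becomes (k_j w_j W - dV/da_j) x a_j = 0, and a vector whose cross
    product with the unit vector a_j vanishes is a multiple of a_j. *)

(** * Vector algebra in dimension three *)

Section VectorAlgebra.
Variable R : realType.
Implicit Types (x y z : vec3 R) (c : R).

Definition dotv x y : R := \sum_i x i 0 * y i 0.

Lemma dotvE x y :
  dotv x y = x 0 0 * y 0 0 + x 1 0 * y 1 0 + x 2 0 * y 2 0.
Proof.
rewrite /dotv !big_ord_recl big_ord0 addr0 addrA.
by congr (x _ _ * y _ _ + x _ _ * y _ _ + x _ _ * y _ _); exact: val_inj.
Qed.

Lemma cross0 x y : cross x y 0 0 = x 1 0 * y 2 0 - x 2 0 * y 1 0.
Proof. by rewrite mxE !add0r. Qed.

Lemma cross1 x y : cross x y 1 0 = x 2 0 * y 0 0 - x 0 0 * y 2 0.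
Proof.
by rewrite mxE; congr (x _ _ * y _ _ - x _ _ * y _ _); exact: val_inj.
Qed.

Lemma cross2 x y : cross x y 2 0 = x 0 0 * y 1 0 - x 1 0 * y 0 0.
Proof.
by rewrite mxE; congr (x _ _ * y _ _ - x _ _ * y _ _); exact: val_inj.
Qed.

Lemma vec3P x y :
  x 0 0 = y 0 0 -> x 1 0 = y 1 0 -> x 2 0 = y 2 0 -> x = y.
Proof.
move=> h0 h1 h2; apply/colP => -[[|[|[|//]]] lti].
- by move: h0; congr (x _ _ = y _ _); exact: val_inj.
- by move: h1; congr (x _ _ = y _ _); exact: val_inj.
- by move: h2; congr (x _ _ = y _ _); exact: val_inj.
Qed.

Lemma crossDr x y z : cross x (y + z) = cross x y + cross x z.
Proof. by rewrite -!mul_hat mulmxDr. Qed.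

Lemma crossBr x y z : cross x (y - z) = cross x y - cross x z.
Proof. by rewrite -!mul_hat mulmxBr. Qed.

Lemma crossZr x c y : cross x (c *: y) = c *: cross x y.
Proof. by rewrite -!mul_hat -scalemxAr. Qed.

Lemma crossC x y : cross x y = - cross y x.
Proof. by apply/colP => i; rewrite !mxE; ring. Qed.

Lemma crossxx x : cross x x = 0.
Proof. by apply/colP => i; rewrite !mxE; ring. Qed.

Lemma hatZ c x : hat (c *: x) = c *: hat x.
Proof. by apply/matrixP => i j; rewrite !mxE; ring. Qed.

Lemma dotv_cross x y : dotv x (cross x y) = 0.
Proof. by rewrite dotvE cross0 cross1 cross2; ring. Qed.

Lemma cross_cross x y z :
  cross x (cross y z) = dotv x z *: y - dotv x y *: z.
Proof.
by apply: vec3P;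
  rewrite ?cross0 ?cross1 ?cross2 !(dotvE, cross0, cross1, cross2, mxE); ring.
Qed.

Lemma enorm1_dotv x : enorm x = 1 -> dotv x x = 1.
Proof.
move=> x1; have -> : dotv x x = enorm x ^+ 2; last by rewrite x1 expr1n.
by rewrite sqr_sqrtr //; apply: sumr_ge0 => i _; exact: sqr_ge0.
Qed.

(** For a unit vector x, [cross x (cross y x)] is the component of y orthogonal
    to x. *)
Lemma cross_eq0_colinear x y :
  enorm x = 1 -> cross y x = 0 -> y = dotv x y *: x.
Proof.
move=> /enorm1_dotv x1 yx; apply/eqP; rewrite -subr_eq0.
have <- : cross x (cross y x) = y - dotv x y *: x.
  by rewrite cross_cross x1 scale1r.
by rewrite yx -mul_hat mulmx0.
Qed.

Lemma hat_cube x : dotv x x = 1 -> hat x ^+ 3 = - hat x.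
Proof.
move=> x1; apply/matrixP => i j.
have /matrixP/(_ i 0) : col j (hat x ^+ 3) = col j (- hat x).
  rewrite !colE mulNmx !exprS expr0 mulr1 -!mulmxA !mul_hat.
  by rewrite cross_cross dotv_cross x1 scale0r sub0r scale1r.
by rewrite [LHS]mxE [RHS]mxE.
Qed.

End VectorAlgebra.

(** * The exponential of an infinitesimal rotation *)

Section Rotation.
Variable R : realType.

(** The relation hat(x)^3 = - hat(x) for a unit vector x reduces every power
    of hat(x) to one of 1, hat(x), hat(x)^2, with the signs of the sine and
    cosine series.  The constant term of the exponential escapes this pattern,
    whence the correction at k = 0. *)
Lemma expmx_hat_coeff (x : vec3 R) (t : R) (k : nat) : dotv x x = 1 ->
  k`!%:R^-1 *: (t *: hat x) ^+ k =
  sin_coeff t k *: hat x - cos_coeff t k *: hat x ^+ 2 +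
  (k == 0%N)%:R *: (1 + hat x ^+ 2).
Proof.
move=> /hat_cube x3; rewrite exprZn scalerA /sin_coeff /cos_coeff /=.
have hat_odd n : hat x ^+ n.*2.+1 = (-1) ^+ n *: hat x.
  elim: n => [|n IHn]; first by rewrite expr1 expr0 scale1r.
  rewrite doubleS 2!exprS IHn -!scalerAr -expr2 -exprS x3.
  by rewrite exprS mulN1r scalerN scaleNr.
have hat_even n : hat x ^+ n.*2.+2 = (-1) ^+ n *: hat x ^+ 2.
  by rewrite exprS hat_odd -scalerAr.
case: k => [|k] /=.
  by rewrite !(mul0r, expr0, fact0, invr1, mul1r, mulr1, scale0r, scale1r)
    sub0r addrC addrK.
rewrite scale0r addr0 -exprnP negbK -(odd_double_half k).
case: (odd k); move: (k./2) => n; rewrite /= ?add1n ?add0n /= odd_double /=.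
  rewrite !mul0r scale0r sub0r mul1r hat_even doubleK scalerA -scaleNr.
  by rewrite (exprS (-1)); congr (_ *: _); ring.
rewrite !mul0r scale0r subr0 mul1r hat_odd doubleK scalerA.
by congr (_ *: _); ring.
Qed.

(** Rodrigues' rotation formula. *)
Lemma expmx_hat (x : vec3 R) (t : R) : dotv x x = 1 ->
  expmx (t *: hat x) = 1 + sin t *: hat x + (1 - cos t) *: hat x ^+ 2.
Proof.
move=> x1; rewrite scalerBl scale1r (addrC 1) (addrC (hat x ^+ 2)) addrACA.
rewrite /expmx; apply/cvg_lim => //; rewrite -cvg_shiftS.
rewrite (_ : (fun n => _) = fun n =>
    series (sin_coeff t) n.+1 *: hat x - series (cos_coeff t) n.+1 *: hat x ^+ 2
    + (1 + hat x ^+ 2)); last first.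
  apply/funext => n; rewrite /series /=.
  under eq_bigr do rewrite expmx_hat_coeff //.
  rewrite big_split sumrB -!scaler_suml /=; congr (_ + _).
  by rewrite big_nat_recl //= big1 // addr0 scale1r.
have cvg_sin : series (sin_coeff t) n.+1 @[n --> \oo] --> sin t.
  by rewrite (cvg_shiftS (series _)) unlock; exact: is_cvg_series_sin_coeff.
have cvg_cos : series (cos_coeff t) n.+1 @[n --> \oo] --> cos t.
  by rewrite (cvg_shiftS (series _)) unlock; exact: is_cvg_series_cos_coeff.
apply: cvgD; last exact: cvg_cst.
by apply: cvgB; exact: cvgZr_tmp.

Qed.

Lemma expmx0 : expmx (0 : 'M[R]_3) = 1.
Proof.
(* Any unit vector will do, since sin 0 = 0 and cos 0 = 1. *)
have e1 : dotv ez ez = 1 :> R by rewrite dotvE !mxE /=; ring.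
rewrite -(scale0r (hat (ez : vec3 R))) expmx_hat // sin0 cos0.
by rewrite subrr !scale0r !addr0.
Qed.

Lemma is_derive_scalel (V : normedModType R) (f : R -> R) (v : V) (t df : R) :
  is_derive t 1 f df -> is_derive t 1 (fun s => f s *: v) (df *: v).
Proof.
move=> [df1 df2].
have lim_quot : h^-1 *: (f (h *: 1 + t) *: v - f t *: v) @[h --> 0^'] --> df *: v.
  rewrite -df2; under eq_fun do rewrite -scalerBl scalerA.
  by apply: cvgZr_tmp; exact: df1.
by split; [apply/cvg_ex; exists (df *: v) | apply/cvg_lim].
Qed.

Lemma is_derive_rotation (w : R) (b : vec3 R) :
  is_derive (0 : R) 1 (fun s => expmx (s *: hat (w *: ez)) *m b)
    (cross (w *: ez) b).
Proof.
have e1 : dotv ez ez = 1 :> R by rewrite dotvE !mxE /=; ring.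
pose J := hat (ez : vec3 R).
rewrite (_ : (fun s => _) = fun s =>
    b + (sin (w * s) *: (J *m b) + (1 - cos (w * s)) *: (J ^+ 2 *m b)));
  last first.
  apply/funext => s; rewrite hatZ scalerA (mulrC s) expmx_hat // !mulmxDl mul1mx.
  by rewrite -!scalemxAl addrA.
have dw : is_derive (0 : R) 1 ( *%R w) w.
  rewrite -[X in is_derive _ _ _ X]mulr1.
  exact: (is_deriveZ w (is_derive_id (0 : R) 1)).
have dsin : is_derive (0 : R) 1 (fun s : R => sin (w * s)) w.
  have := is_derive1_comp (is_derive_sin (w * 0)) dw.
  by rewrite mulr0 cos0 mul1r.
have dcos : is_derive (0 : R) 1 (fun s : R => 1 - cos (w * s)) 0.
  have := is_deriveB (is_derive_cst (1 : R) (0 : R) 1)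
            (is_derive1_comp (is_derive_cos (w * 0)) dw).
  by rewrite mulr0 sin0 oppr0 mul0r subr0.
have := is_deriveD (is_derive_cst b (0 : R) 1)
          (is_deriveD (is_derive_scalel (J *m b) dsin)
                      (is_derive_scalel (J ^+ 2 *m b) dcos)).
by rewrite scale0r addr0 add0r -mul_hat hatZ -scalemxAl.
Qed.

(** The derivative of a rotating vector at time 0 is unique, so any other
    expression for it is equal to the velocity of the rotation. *)
Lemma rotation_velocity (w : R) (b d : vec3 R) (f : R -> vec3 R) :
  (forall s, f s = expmx (s *: hat (w *: ez)) *m b) ->
  is_derive (0 : R) 1 f d -> cross (w *: ez) b = d.
Proof.
move=> /funext -> [_ <-].
by have [_ ->] := is_derive_rotation w b.
Qed.

End Rotation.

(** * Barycentric sums *)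

Section Barycentric.
Variables (R : realType) (V : lmodType R) (N : nat).
Implicit Types (c : 'I_N -> R) (x : 'I_N -> V).

Lemma sum_weighted_diff c x i : \sum_h c h *: x h = 0 ->
  \sum_(h | h != i) c h *: (x i - x h) = (\sum_h c h) *: x i.
Proof.
move=> cx0; transitivity (\sum_h c h *: (x i - x h)).
  by rewrite [RHS](bigD1 i) //= subrr scaler0 add0r.
under eq_bigr do rewrite scalerBr.
by rewrite sumrB cx0 subr0 scaler_suml.
Qed.

Lemma sum_weighted_diffN c x i : \sum_h c h *: x h = 0 ->
  \sum_(h | h != i) c h *: (x h - x i) = - ((\sum_h c h) *: x i).
Proof.
move=> /sum_weighted_diff <-; rewrite -sumrN.
by apply: eq_bigr => h _; rewrite -scalerN opprB.
Qed.

Lemma weighted_const_eq0 c x : \sum_h c h != 0 -> \sum_h c h *: x h = 0 ->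
  (forall i j : 'I_N, (i < j)%N -> x i = x j) -> forall i, x i = 0.
Proof.
move=> c0 cx0 xlt i.
have xi h : x h = x i.
  by have [/xlt|/xlt|/val_inj ->] := ltngtP h i.
apply/eqP; move/eqP: cx0; under eq_bigr do rewrite xi.
by rewrite -scaler_suml scaler_eq0 (negPf c0).
Qed.

End Barycentric.

(** * Relative equilibria *)

(** Axial symmetry makes the inertia tensor in the spatial frame depend on the
    attitude only through the symmetry axis. *)
Lemma axial_inertia_mul (R : realType) (A : 'M[R]_3) (T1 T3 : R) (x : vec3 R) :
  SO3 A ->
  A *m diag_mx (\row_k if k == 2 then T3 else T1) *m A^T *m x =
  T1 *: x + ((T3 - T1) * dotv (col 2 A) x) *: col 2 A.
Proof.
move=> [/mulmx1C AAt _].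
have -> : diag_mx (\row_k if k == 2 then T3 else T1) =
    T1%:M + (T3 - T1) *: (delta_mx 2 0 *m (delta_mx 2 0 : vec3 R)^T).
  rewrite trmx_delta mul_delta_mx; apply/matrixP => i j; rewrite !mxE.
  have [<-|ij] := eqVneq i j; last first.
    rewrite mulr0n add0r; case: (eqVneq i 2) => [i2|_]; rewrite ?mulr0 //=.
    by rewrite eq_sym -i2 (negPf ij) mulr0.
  by have [_|_] := eqVneq i 2; rewrite /= !mulr1n; ring.
rewrite mulmxDr mulmxDl mulmxDl mul_mx_scalar -!scalemxAl AAt mul1mx.
congr (_ + _); rewrite -scalemxAr -!scalemxAl -scalerA; congr (_ *: _).
rewrite mulmxA -colE -!mulmxA (mulmxA _ A^T) -trmx_mul -colE.
rewrite [_ *m x]mx11_scalar mul_mx_scalar; congr (_ *: _).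
by rewrite mxE; apply: eq_bigr => i _; rewrite !mxE.
Qed.

Section RelativeEquilibrium.
Variables (R : realType) (N m : nat) (S : nbody R N m).

Lemma pr_mul (g : 'M[R]_3) (X : pairs R N) i j : pr (g *m X) i j = g *m pr X i j.
Proof.
have col_mul e : pcol (g *m X) e = g *m pcol X e by rewrite /pcol !colE mulmxA.
rewrite /pr; case: insubP => [e _ _|_]; first exact: col_mul.
by case: insubP => [e _ _|_]; rewrite ?col_mul ?mulmxN ?mulmx0.
Qed.

Lemma m_s_neq0 (i : 'I_N) : m_s S != 0.
Proof.
rewrite gt_eqF // /m_s (bigD1 i) //= ltr_pwDl ?sumr_ge0 //; last first.
  by move=> h _; rewrite ltW // mass_gt0.
exact: mass_gt0.
Qed.

(** Because sum m_h q_h = 0, the sum of m_h (q_i - q_h) is m_s q_i. *)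
Lemma bracketE (Q : pairs R N) (q : 'I_N -> vec3 R) (i j : 'I_N) :
  \sum_h m_ S h *: q h = 0 -> (forall h k, pr Q h k = q h - q k) ->
  (m_ S i / m_s S) *: (\sum_(h | h != i) m_ S h *: pr Q i h) +
  (m_ S j / m_s S) *: (\sum_(h | h != j) m_ S h *: pr Q h j) =
  m_ S i *: q i - m_ S j *: q j.
Proof.
move=> mq0 Qq; have ms0 := m_s_neq0 i.
under eq_bigr do rewrite Qq.
under [X in _ + _ *: X]eq_bigr do rewrite Qq.
rewrite sum_weighted_diff // sum_weighted_diffN // scalerN !scalerA.
by rewrite -/(m_s S) !divfK.
Qed.

(** The velocity equation forces p_i / m_i - W x q_i to be the same vector for
    all i.  Its mass-weighted sum is zero because the barycenter is at rest at
    the origin, hence p_i = m_i W x q_i. *)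
Lemma relative_momentum (W : vec3 R) (Q P : pairs R N) (q : 'I_N -> vec3 R) :
  \sum_h m_ S h *: q h = 0 -> (forall h k, pr Q h k = q h - q k) ->
  relative_momenta P ->
  (forall i j : 'I_N, (i < j)%N -> cross W (pr Q i j) =
     (m_ S i)^-1 *: (\sum_(k | k != i) pr P i k) +
     (m_ S j)^-1 *: (\sum_(k | k != j) pr P k j)) ->
  forall i j,
    pr P i j = N%:R^-1 *: cross W (m_ S i *: q i - m_ S j *: q j).
Proof.
move=> mq0 Qq [p [p0 Pp]] dq i j.
have m0 h : m_ S h != 0 by rewrite gt_eqF ?mass_gt0.
have N0 : N%:R != 0 :> R by rewrite pnatr_eq0 -lt0n (leq_ltn_trans _ (ltn_ord i)).
(* the relative momenta are differences weighted by 1/N, of total weight 1 *)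
have cp0 : \sum_(h < N) (N%:R^-1 : R) *: p h = 0.
  by rewrite -scaler_sumr p0 scaler0.
have c1 : \sum_(h < N) (N%:R^-1 : R) = 1.
  by rewrite sumr_const card_ord -[LHS]mulr_natl mulfV.
have sumPl h : \sum_(k | k != h) pr P h k = p h.
  under eq_bigr do rewrite Pp.
  by rewrite (sum_weighted_diff _ cp0) c1 scale1r.
have sumPr h : \sum_(k | k != h) pr P k h = - p h.
  under eq_bigr do rewrite Pp.
  by rewrite (sum_weighted_diffN _ cp0) c1 scale1r.
have pE h : p h = m_ S h *: cross W (q h).
  apply/eqP; rewrite -subr_eq0 -(scalerKV (m0 h) (p h)) -scalerBr scaler_eq0.
  rewrite (negPf (m0 h)) /=; apply/eqP; move: h.
  apply: (@weighted_const_eq0 _ _ _ (m_ S)); first exact: m_s_neq0 i.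
    under eq_bigr do rewrite scalerBr (scalerKV (m0 _)) -crossZr -mul_hat.
    by rewrite sumrB p0 -mulmx_sumr mq0 mulmx0 subr0.
  move=> h k hk; have := dq h k hk.
  rewrite sumPl sumPr Qq crossBr scalerN => dqE.
  by apply/eqP; rewrite -subr_eq0 opprD addrACA -dqE -opprD subrr.
by rewrite Pp !pE crossBr !crossZr.
Qed.

End RelativeEquilibrium.

Theorem theorem4p2 (R : realType) (N m : nat) (S : nbody R N m)
    (V : config R N m -> R) (hV : is_potential S V)
    (omega : R) (z0 : state R N m)
    (hz0 : relative_equilibrium S V omega z0) :
  let W : vec3 R := omega *: ez in
  let q := pr (sQ z0) in
  let p := pr (sP z0) in
  let l j := col j (sl z0) in
  let a j := col j (sa z0) in
  let w j := (sa z0) 2 j in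
  exists k : 'I_m -> R,
    [/\ forall j, k j = omega * (Theta3 S j - Theta1 S j) \/ k j = 0,
        (forall i j : 'I_N, (i < j)%N ->
           p i j = cross W
             ((m_ S i / (N%:R * m_s S)) *: (\sum_(h | h != i) m_ S h *: q i h) +
              (m_ S j / (N%:R * m_s S)) *: (\sum_(h | h != j) m_ S h *: q h j)))
        /\ (forall j : 'I_m, l j = Theta1 S j *: W + (k j * w j) *: a j) &
        (forall (i j : 'I_N) (ij : (i < j)%N),
           N%:R^-1 *: (hat W ^+ 2 *m
             ((m_ S i / m_s S) *: (\sum_(h | h != i) m_ S h *: q i h) +
              (m_ S j / m_s S) *: (\sum_(h | h != j) m_ S h *: q h j)))
           = - dVdq V (sQ z0) (sa z0) (Edge ij))
        /\ (forall j : 'I_m, exists mu : R,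
              mu *: a j = (k j * w j) *: W - dVda V (sQ z0) (sa z0) j)].
Proof.
move=> W q p l a w; have [sol [A HA]] := hz0.
have z0E : act (expmx (0 *: hat W)) z0 = z0.
  by rewrite scale0r expmx0; case: (z0) => *; rewrite /act /= !mul1mx.
have [q_ [mq0 Qq]] : relative_positions S (sQ z0).
  by have := sol_Q sol 0; rewrite z0E.
have Prel : relative_momenta (sP z0) by have := sol_P sol 0; rewrite z0E.
have a1 j : enorm (a j) = 1 by have := sol_a sol 0 j; rewrite z0E.
(* At time 0 every left-hand side of the equations of motion is a rotational
   velocity, which turns these equations into algebraic relations. *)
have dQ (i j : 'I_N) : (i < j)%N -> cross W (q i j) =
    (m_ S i)^-1 *: (\sum_(k | k != i) p i k) +
    (m_ S j)^-1 *: (\sum_(k | k != j) p k j).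
  move=> ij; have := sol_dQ sol 0 ij; rewrite z0E.
  by apply: rotation_velocity => s; rewrite pr_mul.
have dP (i j : 'I_N) (ij : (i < j)%N) :
    cross W (p i j) = - dVdq V (sQ z0) (sa z0) (Edge ij).
  have := sol_dP sol 0 ij; rewrite z0E.
  by apply: rotation_velocity => s; rewrite pr_mul.
have dl j : cross W (l j) = cross (dVda V (sQ z0) (sa z0) j) (a j).
  have := sol_dl sol 0 j; rewrite z0E.
  by apply: rotation_velocity => s; rewrite colE -mulmxA -colE.
have pE := relative_momentum mq0 Qq Prel dQ.
pose k j := omega * (Theta3 S j - Theta1 S j).
have lE j : l j = Theta1 S j *: W + (k j * w j) *: a j.
  rewrite /l; have [/(_ 0)[soA colA _] ->] := HA j.
  rewrite inertia_axial axial_inertia_mul // colA z0E -/(a j).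
  congr (_ + _ *: _); rewrite dotvE /W !mxE /= /k /w; ring.
exists k; split; first by left.
- split=> // i j ij; rewrite /p pE -crossZr -(bracketE _ _ mq0 Qq).
  by rewrite scalerDr !scalerA !invfM; congr (cross W (_ *: _ + _ *: _)); ring.
- split=> [i j ij|j].
    rewrite -dP (bracketE _ _ mq0 Qq) /p pE expr2 -mulmxA !mul_hat.
    by rewrite -crossZr.
  set F := dVda V _ _ _; exists (dotv (a j) ((k j * w j) *: W - F)).
  rewrite -cross_eq0_colinear //.
  rewrite crossC crossBr (crossC (a j) F) -dl lE crossDr.
  rewrite (crossZr W (Theta1 S j)) crossxx scaler0 add0r.
  rewrite crossZr (crossC (a j) W) !(crossZr W (k j * w j)).
  by rewrite scalerN opprK addNr oppr0.
Qed.
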